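(* Let $R$ be a commutative ring with identity and $A$ a commutative $R$-algebra with identity. Let $F_A = A\otimes_R S(A)$, where $S(A)$ is the symmetric algebra of the $R$-module $A$, let $f_A:F_A\to F_A$ be the $R$-linear map with $f_A(a\otimes s)=1_A\otimes (as)$ for $a\in A$, $s\in S(A)$, and let $i_A:A\to F_A$, $i_A(a)=a\otimes 1_R$. Then $(F_A,f_A)$ together with $i_A$ is a free averaging $R$-algebra on $A$. In other words, for any averaging $R$-algebra $(B,g)$ and any $R$-algebra homomorphism $\varphi:A\to B$, there exists a unique averaging homomorphism $\hat\varphi:(F_A,f_A)\to(B,g)$ such that $\varphi=\hat\varphi\circ i_A$.
   Context: All rings and algebras are commutative with identity, and algebra homomorphisms preserve the identity. An averaging operator on an $R$-algebra $B$ is an $R$-module endomorphism $g:B\to B$ with $g(xg(y))=g(x)g(y)$ for all $x,y\in B$; the pair $(B,g)$ is then called an averaging $R$-algebra. An averaging homomorphism $(B,g)\to(C,h)$ is an $R$-algebra homomorphism $\psi:B\to C$ with $\psi\circ g=h\circ\psi$. $S(A)=\bigoplus_{n\ge 0}S^n(A)$ is the symmetric algebra of the $R$-module $A$, with $S^0(A)=R$ and $S^1(A)=A$; in $as$ (for $a\in A$, $s\in S(A)$) the element $a$ is regarded as an element of $S^1(A)$ and the product is that of $S(A)$. $F_A$ has the tensor product algebra multiplication $(a\otimes s)(a'\otimes s')=aa'\otimes ss'$. $f_A$ is well defined and is an averaging operator on $F_A$. *)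

(* Defs.v *)
(* MathComp; boolp decides the congruences by which quotients are taken. *)
From HB Require Import structures.
From mathcomp Require Import all_boot all_algebra.
From mathcomp Require Import boolp.

Set Implicit Arguments.
Unset Strict Implicit.
Unset Printing Implicit Defensive.

Import GRing.Theory.
Local Open Scope ring_scope.
Local Open Scope quotient_scope.

(* A commutative R-algebra as a commutative ring with a ring morphism from R.
   MathComp's comAlgType excludes the zero ring, both as base ring and as
   algebra, and Hierarchy Builder accepts no structure joining lmodType and
   comPzRingType to which the algebra axiom could be added. *)
HB.mixin Record hasAlgMap (R : comPzRingType) A of GRing.ComPzRing A := {
  alg_map : {rmorphism R -> A}
}.

#[short(type="pzComAlgType")]
HB.structure Definition PzComAlg (R : comPzRingType) :=
  { A of GRing.ComPzRing A & hasAlgMap R A }.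

(* The R-module underlying an algebra. *)
Definition algmod (R : comPzRingType) (A : pzComAlgType R) : Type := A.

Section AlgMod.
Variables (R : comPzRingType) (A : pzComAlgType R).

HB.instance Definition _ := GRing.ComPzRing.on (algmod A).

Definition alg_scale (r : R) (x : algmod A) : algmod A := alg_map r * x.

Lemma alg_scaleA r s x : alg_scale r (alg_scale s x) = alg_scale (r * s) x.
Proof. by rewrite /alg_scale rmorphM mulrA. Qed.

Lemma alg_scale1 : left_id 1 alg_scale.
Proof. by move=> x; rewrite /alg_scale rmorph1 mul1r. Qed.

Lemma alg_scaleDr : right_distributive alg_scale +%R.
Proof. by move=> r x y; apply: mulrDr. Qed.

Lemma alg_scaleDl x : {morph alg_scale^~ x : r s / r + s}.
Proof. by move=> r s; rewrite /alg_scale rmorphD mulrDl. Qed.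

HB.instance Definition _ := GRing.Zmodule_isLmodule.Build R (algmod A)
  alg_scaleA alg_scale1 alg_scaleDr alg_scaleDl.

Lemma algmodZ (r : R) (x : algmod A) : r *: x = alg_map r * x.
Proof. by []. Qed.

Lemma algmod_scalerAl (r : R) (x y : algmod A) : r *: (x * y) = r *: x * y.
Proof. exact: mulrA. Qed.

Lemma algmod_scalerAr (r : R) (x y : algmod A) : r *: (x * y) = x * (r *: y).
Proof. exact: mulrCA. Qed.

End AlgMod.

Section Maps.
Variable R : comPzRingType.

(* monoid_morphism is the conjunction of f 1 = 1 and multiplicativity. *)
Definition is_alg_hom (A B : pzComAlgType R) (f : A -> B) : Prop :=
  linear (f : algmod A -> algmod B) /\ monoid_morphism f.

Definition is_averaging (B : pzComAlgType R) (g : B -> B) : Prop :=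
  linear (g : algmod B -> algmod B) /\ forall x y : B, g (x * g y) = g x * g y.

Definition is_averaging_hom (B C : pzComAlgType R) (g : B -> B) (h : C -> C)
    (psi : B -> C) : Prop :=
  is_alg_hom psi /\ psi \o g =1 h \o psi.

Definition is_free_averaging (A F : pzComAlgType R) (f : F -> F) (i : A -> F) :
    Prop :=
  [/\ is_averaging f, is_alg_hom i &
      forall (B : pzComAlgType R) (g : B -> B) (phi : A -> B),
        is_averaging g -> is_alg_hom phi ->
        exists! psi : F -> B, is_averaging_hom f g psi /\ phi =1 psi \o i].

End Maps.

(* The commutative monoid with generators K and relations E: finite formal sums
   of generators, modulo the least congruence containing E. *)
Section Presentation.
Variables (K : choiceType) (E : seq K -> seq K -> Prop).

Inductive pres_cong : seq K -> seq K -> Prop :=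
| pres_rel s t : E s t -> pres_cong s t
| pres_perm s t : perm_eq s t -> pres_cong s t
| pres_cat s s' t t' :
    pres_cong s s' -> pres_cong t t' -> pres_cong (s ++ t) (s' ++ t')
| pres_sym s t : pres_cong s t -> pres_cong t s
| pres_trans s t u : pres_cong s t -> pres_cong t u -> pres_cong s u.

Definition pres_eqv (s t : seq K) : bool := `[< pres_cong s t >].

Lemma pres_eqv_refl : reflexive pres_eqv.
Proof. by move=> s; apply/asboolP/pres_perm/perm_refl. Qed.

Lemma pres_eqv_sym : symmetric pres_eqv.
Proof. by move=> s t; apply/asboolP/asboolP; apply: pres_sym. Qed.

Lemma pres_eqv_trans : transitive pres_eqv.
Proof.
by move=> t s u /asboolP st /asboolP tu; apply/asboolP/(pres_trans st tu).
Qed.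

Canonical pres_equiv := EquivRel pres_eqv pres_eqv_refl pres_eqv_sym pres_eqv_trans.

Definition pres := {eq_quot pres_equiv}.
HB.instance Definition _ := Choice.on pres.
HB.instance Definition _ := Quotient.on pres.

Lemma pres_eqP (s t : seq K) : \pi_pres s = \pi_pres t <-> pres_cong s t.
Proof.
split=> [/eqmodP/asboolP //|st]; apply/eqmodP/asboolP; exact: st.
Qed.

Lemma pres_reprP (s : seq K) : pres_cong (repr (\pi_pres s)) s.
Proof. by apply/pres_eqP; rewrite reprK. Qed.

Lemma pres_piW (P : pres -> Prop) : (forall s, P (\pi_pres s)) -> forall x, P x.
Proof. by move=> Ps x; rewrite -[x]reprK; apply: Ps. Qed.

Definition pres_add (x y : pres) : pres := \pi_pres (repr x ++ repr y).

Lemma pres_addE s t : pres_add (\pi_pres s) (\pi_pres t) = \pi_pres (s ++ t).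
Proof. by apply/pres_eqP/pres_cat; apply: pres_reprP. Qed.

Lemma pres_addA : associative pres_add.
Proof.
by elim/pres_piW=> s; elim/pres_piW=> t; elim/pres_piW=> u; rewrite !pres_addE catA.
Qed.

Lemma pres_addC : commutative pres_add.
Proof.
elim/pres_piW=> s; elim/pres_piW=> t; rewrite !pres_addE.
by apply/pres_eqP/pres_perm; rewrite perm_catC.
Qed.

Lemma pres_add0 : left_id (\pi_pres [::]) pres_add.
Proof. by elim/pres_piW=> s; rewrite pres_addE. Qed.

HB.instance Definition _ :=
  GRing.isNmodule.Build pres pres_addA pres_addC pres_add0.

Definition pres_gen (k : K) : pres := \pi_pres [:: k].

Lemma pres_piE s : \pi_pres s = \sum_(k <- s) pres_gen k.
Proof.
elim: s => [|k s IH]; first by rewrite big_nil.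
by rewrite big_cons -IH [RHS]pres_addE.
Qed.

Lemma pres_ind (P : pres -> Prop) :
  P 0 -> (forall x y, P x -> P y -> P (x + y)) -> (forall k, P (pres_gen k)) ->
  forall x, P x.
Proof. by move=> P0 PD Pg; elim/pres_piW=> s; rewrite pres_piE; apply: big_ind. Qed.

Lemma pres_genE s t : E s t ->
  \sum_(k <- s) pres_gen k = \sum_(k <- t) pres_gen k.
Proof. by move=> st; rewrite -!pres_piE; apply/pres_eqP/pres_rel. Qed.

Section Lift.
Variable V : nmodType.
Implicit Type F : K -> V.

Definition pres_compat F : Prop :=
  forall s t, E s t -> \sum_(k <- s) F k = \sum_(k <- t) F k.

(* Independent of the representative when pres_compat F holds. *)
Definition pres_lift F (x : pres) : V := \sum_(k <- repr x) F k.

Lemma pres_liftE F s : pres_compat F ->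
  pres_lift F (\pi_pres s) = \sum_(k <- s) F k.
Proof.
move=> FE; suff FC t u : pres_cong t u -> \sum_(k <- t) F k = \sum_(k <- u) F k.
  exact/FC/pres_reprP.
elim=> {t u} [t u /FE //|t u tu|t t' u u' _ IHt _ IHu|t u _ -> //|t u v _ -> _ ->//].
- exact: perm_big.
- by rewrite !big_cat /= IHt IHu.
Qed.

Lemma pres_lift_gen F k : pres_compat F -> pres_lift F (pres_gen k) = F k.
Proof. by move=> FE; rewrite pres_liftE // big_seq1. Qed.

Lemma pres_lift0 F : pres_compat F -> pres_lift F 0 = 0.
Proof. by move=> FE; rewrite [LHS]pres_liftE // big_nil. Qed.

Lemma pres_liftD F : pres_compat F -> {morph pres_lift F : x y / x + y}.
Proof.
move=> FE; elim/pres_piW=> s; elim/pres_piW=> t.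
by rewrite [_ + _]pres_addE !pres_liftE // big_cat.
Qed.

End Lift.
End Presentation.

Section Lift2.
Variables (K : choiceType) (E : seq K -> seq K -> Prop).
Variables (L : choiceType) (D : seq L -> seq L -> Prop).
Variable V : nmodType.
Variable G : K -> L -> V.
Hypothesis GE : forall l, pres_compat E (G^~ l).
Hypothesis GD : forall k, pres_compat D (G k).

Definition pres_lift2 (x : pres E) (y : pres D) : V :=
  pres_lift (fun k => pres_lift (G k) y) x.

Lemma pres_lift2_compat (y : pres D) : pres_compat E (fun k => pres_lift (G k) y).
Proof.
move=> s t st; elim/(@pres_ind L D): y => [|x y IHx IHy|l].
- by rewrite !big1 // => k _; rewrite pres_lift0.
- under eq_bigr do rewrite pres_liftD //.
  rewrite big_split /= IHx IHy -big_split /=.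
  by apply: eq_bigr => k _; rewrite pres_liftD.
- under eq_bigr do rewrite pres_lift_gen //.
  by rewrite (GE l st); apply: eq_bigr => k _; rewrite pres_lift_gen.
Qed.

Lemma pres_lift2_gen k l : pres_lift2 (pres_gen E k) (pres_gen D l) = G k l.
Proof.
by rewrite /pres_lift2 pres_lift_gen ?pres_lift_gen //; apply: pres_lift2_compat.
Qed.

Lemma pres_lift2Dl y : {morph pres_lift2^~ y : x x' / x + x'}.
Proof. by move=> x x'; apply/pres_liftD/pres_lift2_compat. Qed.

Lemma pres_lift2Dr x : {morph pres_lift2 x : y y' / y + y'}.
Proof.
move=> y y'; rewrite /pres_lift2 /pres_lift -big_split /=.
by apply: eq_bigr => k _; apply: pres_liftD.
Qed.

Lemma pres_lift20l y : pres_lift2 0 y = 0.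
Proof. by apply/pres_lift0/pres_lift2_compat. Qed.

Lemma pres_lift20r x : pres_lift2 x 0 = 0.
Proof.
by rewrite /pres_lift2 /pres_lift big1 // => k _; apply: pres_lift0.
Qed.

End Lift2.

Section TensorModule.
Variables (R : comPzRingType) (M N : lmodType R).

Inductive tensor_rel : seq (M * N) -> seq (M * N) -> Prop :=
| tensor_relDl m m' n : tensor_rel [:: (m + m', n)] [:: (m, n); (m', n)]
| tensor_relDr m n n' : tensor_rel [:: (m, n + n')] [:: (m, n); (m, n')]
| tensor_rel0l n : tensor_rel [:: (0, n)] [::]
| tensor_rel0r m : tensor_rel [:: (m, 0)] [::]
| tensor_relZ r m n : tensor_rel [:: (r *: m, n)] [:: (m, r *: n)].

Definition tensor := pres tensor_rel.
HB.instance Definition _ := GRing.Nmodule.on tensor.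

Definition tens (m : M) (n : N) : tensor := pres_gen tensor_rel (m, n).

Lemma tensDl m m' n : tens (m + m') n = tens m n + tens m' n.
Proof.
by have := pres_genE (tensor_relDl m m' n); rewrite !big_cons !big_nil !addr0.
Qed.

Lemma tensDr m n n' : tens m (n + n') = tens m n + tens m n'.
Proof.
by have := pres_genE (tensor_relDr m n n'); rewrite !big_cons !big_nil !addr0.
Qed.

Lemma tens0l n : tens 0 n = 0.
Proof. by have := pres_genE (tensor_rel0l n); rewrite big_seq1 big_nil. Qed.

Lemma tens0r m : tens m 0 = 0.
Proof. by have := pres_genE (tensor_rel0r m); rewrite big_seq1 big_nil. Qed.

Lemma tensZ r m n : tens (r *: m) n = tens m (r *: n).
Proof. by have := pres_genE (tensor_relZ r m n); rewrite !big_seq1. Qed.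

Lemma tensor_ind (P : tensor -> Prop) :
  P 0 -> (forall x y, P x -> P y -> P (x + y)) ->
  (forall m n, P (tens m n)) -> forall x, P x.
Proof. by move=> P0 PD Pt; apply: pres_ind => // -[m n]; apply: Pt. Qed.

Lemma tensor_compat (V : nmodType) (F : M -> N -> V) :
  (forall m m' n, F (m + m') n = F m n + F m' n) ->
  (forall m n n', F m (n + n') = F m n + F m n') ->
  (forall n, F 0 n = 0) -> (forall m, F m 0 = 0) ->
  (forall r m n, F (r *: m) n = F m (r *: n)) ->
  pres_compat tensor_rel (fun k => F k.1 k.2).
Proof.
by move=> FDl FDr F0l F0r FZ s t []*; rewrite !(big_cons, big_nil) ?addr0 /=.
Qed.

Definition tensor_scale (r : R) : tensor -> tensor :=
  pres_lift (fun k => tens (r *: k.1) k.2).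

Lemma tensor_scale_compat r :
  pres_compat tensor_rel (fun k => tens (r *: k.1) k.2).
Proof.
apply: (@tensor_compat _ (fun m n => tens (r *: m) n)) => *.
- by rewrite scalerDr tensDl.
- by rewrite tensDr.
- by rewrite scaler0 tens0l.
- by rewrite tens0r.
- by rewrite scalerA mulrC -scalerA tensZ.
Qed.

Lemma tensor_scaleE r m n : tensor_scale r (tens m n) = tens (r *: m) n.
Proof. exact: pres_lift_gen (tensor_scale_compat r). Qed.

Lemma tensor_scale0r r : tensor_scale r 0 = 0.
Proof. exact: pres_lift0 (tensor_scale_compat r). Qed.

Lemma tensor_scaleDr r : {morph tensor_scale r : x y / x + y}.
Proof. exact: pres_liftD (tensor_scale_compat r). Qed.

Lemma tensor_scaleDl x : {morph tensor_scale^~ x : r r' / r + r'}.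
Proof.
move=> r r' /=; elim/tensor_ind: x => [|x y IHx IHy|m n].
- by rewrite !tensor_scale0r addr0.
- by rewrite !tensor_scaleDr IHx IHy addrACA.
- by rewrite !tensor_scaleE scalerDl tensDl.
Qed.

Lemma tensor_scaleA r r' x :
  tensor_scale r (tensor_scale r' x) = tensor_scale (r * r') x.
Proof.
elim/tensor_ind: x => [|x y IHx IHy|m n]; first by rewrite !tensor_scale0r.
- by rewrite !tensor_scaleDr IHx IHy.
- by rewrite !tensor_scaleE scalerA.
Qed.

Lemma tensor_scale1 : left_id 1 tensor_scale.
Proof.
elim/tensor_ind=> [|x y IHx IHy|m n]; first by rewrite !tensor_scale0r.
- by rewrite !tensor_scaleDr IHx IHy.
- by rewrite !tensor_scaleE scale1r.
Qed.

Lemma tensor_addN : left_inverse 0 (tensor_scale (- 1)) +%R.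
Proof.
move=> x; rewrite -[X in _ + X]tensor_scale1 -tensor_scaleDl addNr.
elim/tensor_ind: x => [|x y IHx IHy|m n]; first by rewrite !tensor_scale0r.
- by rewrite !tensor_scaleDr IHx IHy addr0.
- by rewrite !tensor_scaleE scale0r tens0l.
Qed.

HB.instance Definition _ := GRing.Nmodule_isZmodule.Build tensor tensor_addN.
HB.instance Definition _ := GRing.Zmodule_isLmodule.Build R tensor
  tensor_scaleA tensor_scale1 tensor_scaleDr tensor_scaleDl.

Lemma tensZl r m n : r *: tens m n = tens (r *: m) n.
Proof. exact: tensor_scaleE. Qed.

End TensorModule.

Section TensorAlgebra.
Variables (R : comPzRingType) (A B : pzComAlgType R).

Definition tensor_mul :
    tensor (algmod A) (algmod B) -> tensor (algmod A) (algmod B) ->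
    tensor (algmod A) (algmod B) :=
  pres_lift2 (fun k l : algmod A * algmod B => tens (k.1 * l.1) (k.2 * l.2)).

Lemma tensor_mul_compatr (k : algmod A * algmod B) :
  pres_compat (@tensor_rel R (algmod A) (algmod B)) (fun l => tens (k.1 * l.1) (k.2 * l.2)).
Proof.
apply: (@tensor_compat _ _ _ _ (fun a b => tens (k.1 * a) (k.2 * b))) => *.
- by rewrite mulrDr tensDl.
- by rewrite mulrDr tensDr.
- by rewrite mulr0 tens0l.
- by rewrite mulr0 tens0r.
- by rewrite -!algmod_scalerAr tensZ.
Qed.

Lemma tensor_mul_compatl (l : algmod A * algmod B) :
  pres_compat (@tensor_rel R (algmod A) (algmod B)) (fun k => tens (k.1 * l.1) (k.2 * l.2)).
Proof.
move=> s t st; under eq_bigr do rewrite mulrC [_ * l.2]mulrC.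
rewrite (tensor_mul_compatr l st).
by under eq_bigr do rewrite mulrC [l.2 * _]mulrC.
Qed.

Lemma tensor_mulE a b a' b' :
  tensor_mul (tens a b) (tens a' b') = tens (a * a') (b * b').
Proof.
exact: (pres_lift2_gen tensor_mul_compatl tensor_mul_compatr (a, b) (a', b')).
Qed.

Lemma tensor_mulDl : left_distributive tensor_mul +%R.
Proof.
by move=> x y z; apply: (pres_lift2Dl tensor_mul_compatl tensor_mul_compatr).
Qed.

Lemma tensor_mulDr : right_distributive tensor_mul +%R.
Proof. by move=> x y z; apply: (pres_lift2Dr tensor_mul_compatr). Qed.

Lemma tensor_mul0l : left_zero 0 tensor_mul.
Proof.
by move=> x; apply: (pres_lift20l tensor_mul_compatl tensor_mul_compatr).
Qed.

Lemma tensor_mul0r : right_zero 0 tensor_mul.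
Proof. by move=> x; apply: (pres_lift20r tensor_mul_compatr). Qed.

Lemma tensor_mulC : commutative tensor_mul.
Proof.
elim/tensor_ind=> [|x x' IHx IHx'|a b] y.
- by rewrite tensor_mul0l tensor_mul0r.
- by rewrite tensor_mulDl tensor_mulDr IHx IHx'.
elim/tensor_ind: y => [|y y' IHy IHy'|a' b'].
- by rewrite tensor_mul0l tensor_mul0r.
- by rewrite tensor_mulDl tensor_mulDr IHy IHy'.
- by rewrite !tensor_mulE mulrC [b * _]mulrC.
Qed.

Lemma tensor_mulA : associative tensor_mul.
Proof.
move=> x y z.
elim/tensor_ind: x => [|x x' IHx IHx'|a b]; first by rewrite !tensor_mul0l.
  by rewrite !tensor_mulDl IHx IHx'.
elim/tensor_ind: y => [|y y' IHy IHy'|a' b'].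
- by rewrite !(tensor_mul0l, tensor_mul0r).
- by rewrite !(tensor_mulDl, tensor_mulDr) IHy IHy'.
elim/tensor_ind: z => [|z z' IHz IHz'|a'' b''].
- by rewrite !(tensor_mul0l, tensor_mul0r).
- by rewrite !tensor_mulDr IHz IHz'.
- by rewrite !tensor_mulE !mulrA.
Qed.

Lemma tensor_mul1 : left_id (tens (1 : algmod A) (1 : algmod B)) tensor_mul.
Proof.
elim/tensor_ind=> [|x x' IHx IHx'|a b]; first by rewrite tensor_mul0r.
- by rewrite tensor_mulDr IHx IHx'.
- by rewrite tensor_mulE !mul1r.
Qed.

HB.instance Definition _ := GRing.Zmodule_isComPzRing.Build (tensor (algmod A) (algmod B))
  tensor_mulA tensor_mulC tensor_mul1 tensor_mulDl.

Lemma tensM a b a' b' :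
  tens a b * tens a' b' = tens (a * a') (b * b') :> tensor (algmod A) (algmod B).
Proof. exact: tensor_mulE. Qed.

Lemma tens1 : 1 = tens (1 : algmod A) (1 : algmod B) :> tensor (algmod A) (algmod B).
Proof. by []. Qed.

Lemma tensor_scalerAl (r : R) (x y : tensor (algmod A) (algmod B)) : r *: (x * y) = r *: x * y.
Proof.
elim/tensor_ind: x => [|x x' IHx IHx'|a b].
- by rewrite mul0r scaler0 mul0r.
- by rewrite mulrDl !scalerDr IHx IHx' mulrDl.
elim/tensor_ind: y => [|y y' IHy IHy'|a' b'].
- by rewrite !mulr0 scaler0.
- by rewrite !mulrDr scalerDr IHy IHy'.
- rewrite tensZl [tens a b * _]tensor_mulE [_ * tens _ _]tensor_mulE.
  by rewrite tensZl algmod_scalerAl.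
Qed.

Definition tensor_alg_map (r : R) : tensor (algmod A) (algmod B) :=
  tens (r *: (1 : algmod A)) (1 : algmod B).

Lemma tensor_alg_mapE r : tensor_alg_map r = r *: (1 : tensor (algmod A) (algmod B)).
Proof. by rewrite tens1 tensZl. Qed.

Lemma tensor_alg_mapB : zmod_morphism tensor_alg_map.
Proof. by move=> r s; rewrite !tensor_alg_mapE scalerBl. Qed.

Lemma tensor_alg_mapM : monoid_morphism tensor_alg_map.
Proof.
split=> [|r s]; rewrite !tensor_alg_mapE ?scale1r //.
by rewrite -tensor_scalerAl mul1r scalerA.
Qed.

HB.instance Definition _ :=
  GRing.isZmodMorphism.Build R _ tensor_alg_map tensor_alg_mapB.
HB.instance Definition _ :=
  GRing.isMonoidMorphism.Build R _ tensor_alg_map tensor_alg_mapM.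
HB.instance Definition _ :=
  hasAlgMap.Build R (tensor (algmod A) (algmod B)) tensor_alg_map.

Lemma tensor_algmodZ (r : R) (x : tensor (algmod A) (algmod B)) :
  r *: (x : algmod (tensor (algmod A) (algmod B))) = r *: x.
Proof. by rewrite [LHS]algmodZ -[in RHS](mul1r x) tensor_scalerAl -tensor_alg_mapE. Qed.

Definition algtensor := tensor (algmod A) (algmod B).
HB.instance Definition _ := PzComAlg.on algtensor.

Definition algtens (a : A) (b : B) : algtensor :=
  tens (a : algmod A) (b : algmod B).

Lemma algtensM a b a' b' :
  algtens a b * algtens a' b' = algtens (a * a') (b * b').
Proof. exact: tensM. Qed.

Lemma algtens1 : 1 = algtens 1 1.
Proof. by []. Qed.

Lemma algtensDl a a' b : algtens (a + a') b = algtens a b + algtens a' b.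
Proof. exact: tensDl. Qed.

Lemma algtensDr a b b' : algtens a (b + b') = algtens a b + algtens a b'.
Proof. exact: tensDr. Qed.

Lemma algtensZl (r : R) a b :
  r *: (algtens a b : algmod algtensor) = algtens (r *: (a : algmod A)) b.
Proof. by rewrite [LHS]tensor_algmodZ tensZl. Qed.

Lemma algtensZr (r : R) a b :
  r *: (algtens a b : algmod algtensor) = algtens a (r *: (b : algmod B)).
Proof. by rewrite algtensZl; apply: tensZ. Qed.

Lemma algtensor_ind (P : algtensor -> Prop) :
  P 0 -> (forall x y, P x -> P y -> P (x + y)) ->
  (forall a b, P (algtens a b)) -> forall x, P x.
Proof. exact: tensor_ind. Qed.

End TensorAlgebra.

(* The pair (r, [:: m1; ..; mn]) stands for r m1 ... mn. Every relation is
   homogeneous in n, and the part of degree n is the n-th tensor power of M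
   modulo permutations of the factors. *)
Section SymmetricAlgebra.
Variables (R : comPzRingType) (M : lmodType R).

Inductive sym_rel : seq (R * seq M) -> seq (R * seq M) -> Prop :=
| sym_relDc r r' w : sym_rel [:: (r + r', w)] [:: (r, w); (r', w)]
| sym_rel0c w : sym_rel [:: (0, w)] [::]
| sym_relD r m m' w :
    sym_rel [:: (r, m + m' :: w)] [:: (r, m :: w); (r, m' :: w)]
| sym_relZ r c m w : sym_rel [:: (r, c *: m :: w)] [:: (r * c, m :: w)]
| sym_relP r w w' : perm_eq w w' -> sym_rel [:: (r, w)] [:: (r, w')].

Definition symalg := pres sym_rel.
HB.instance Definition _ := GRing.Nmodule.on symalg.

Definition sym_mon (r : R) (w : seq M) : symalg := pres_gen sym_rel (r, w).

Lemma sym_monDc r r' w : sym_mon (r + r') w = sym_mon r w + sym_mon r' w.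
Proof.
by have := pres_genE (sym_relDc r r' w); rewrite !big_cons !big_nil !addr0.
Qed.

Lemma sym_mon0c w : sym_mon 0 w = 0.
Proof. by have := pres_genE (sym_rel0c w); rewrite big_seq1 big_nil. Qed.

Lemma sym_monD r m m' w :
  sym_mon r (m + m' :: w) = sym_mon r (m :: w) + sym_mon r (m' :: w).
Proof.
by have := pres_genE (sym_relD r m m' w); rewrite !big_cons !big_nil !addr0.
Qed.

Lemma sym_monZ r c m w : sym_mon r (c *: m :: w) = sym_mon (r * c) (m :: w).
Proof. by have := pres_genE (sym_relZ r c m w); rewrite !big_seq1. Qed.

Lemma sym_monP r w w' : perm_eq w w' -> sym_mon r w = sym_mon r w'.
Proof. by move=> /(sym_relP r)/pres_genE; rewrite !big_seq1. Qed.

Lemma symalg_ind (P : symalg -> Prop) :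
  P 0 -> (forall x y, P x -> P y -> P (x + y)) ->
  (forall r w, P (sym_mon r w)) -> forall x, P x.
Proof. by move=> P0 PD Pt; apply: pres_ind => // -[r w]; apply: Pt. Qed.

Lemma sym_compat (V : nmodType) (F : R -> seq M -> V) :
  (forall r r' w, F (r + r') w = F r w + F r' w) ->
  (forall w, F 0 w = 0) ->
  (forall r m m' w, F r (m + m' :: w) = F r (m :: w) + F r (m' :: w)) ->
  (forall r c m w, F r (c *: m :: w) = F (r * c) (m :: w)) ->
  (forall r w w', perm_eq w w' -> F r w = F r w') ->
  pres_compat sym_rel (fun k => F k.1 k.2).
Proof.
move=> FDc F0c FD FZ FP s t [] > => [||||ww'];
  by rewrite !(big_cons, big_nil) ?addr0 //=; apply: FP.
Qed.

Definition sym_mul : symalg -> symalg -> symalg :=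
  pres_lift2 (fun k l => sym_mon (k.1 * l.1) (k.2 ++ l.2)).

Lemma sym_mul_compatl (l : R * seq M) :
  pres_compat sym_rel (fun k => sym_mon (k.1 * l.1) (k.2 ++ l.2)).
Proof.
apply: (@sym_compat _ (fun r w => sym_mon (r * l.1) (w ++ l.2))).
- by move=> *; rewrite mulrDl sym_monDc.
- by move=> *; rewrite mul0r sym_mon0c.
- by move=> *; rewrite sym_monD.
- by move=> *; rewrite sym_monZ mulrAC.
- by move=> r w w' ww'; apply: sym_monP; rewrite perm_cat2r.
Qed.

Lemma sym_mul_compatr (k : R * seq M) :
  pres_compat sym_rel (fun l => sym_mon (k.1 * l.1) (k.2 ++ l.2)).
Proof.
have kC l : sym_mon (k.1 * l.1) (k.2 ++ l.2) = sym_mon (l.1 * k.1) (l.2 ++ k.2).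
  by rewrite mulrC; apply: sym_monP; rewrite perm_catC.
move=> s t st; under eq_bigr do rewrite kC.
by rewrite (sym_mul_compatl k st); under [RHS]eq_bigr do rewrite kC.
Qed.

Lemma sym_mulE r w r' w' :
  sym_mul (sym_mon r w) (sym_mon r' w') = sym_mon (r * r') (w ++ w').
Proof.
exact: (pres_lift2_gen sym_mul_compatl sym_mul_compatr (r, w) (r', w')).
Qed.

Lemma sym_mulDl : left_distributive sym_mul +%R.
Proof.
by move=> x y z; apply: (pres_lift2Dl sym_mul_compatl sym_mul_compatr).
Qed.

Lemma sym_mulDr : right_distributive sym_mul +%R.
Proof. by move=> x y z; apply: (pres_lift2Dr sym_mul_compatr). Qed.

Lemma sym_mul0l : left_zero 0 sym_mul.
Proof. by move=> x; apply: (pres_lift20l sym_mul_compatl sym_mul_compatr). Qed.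

Lemma sym_mul0r : right_zero 0 sym_mul.
Proof. by move=> x; apply: (pres_lift20r sym_mul_compatr). Qed.

Lemma sym_mulC : commutative sym_mul.
Proof.
elim/symalg_ind=> [|x x' IHx IHx'|r w] y.
- by rewrite sym_mul0l sym_mul0r.
- by rewrite sym_mulDl sym_mulDr IHx IHx'.
elim/symalg_ind: y => [|y y' IHy IHy'|r' w'].
- by rewrite sym_mul0l sym_mul0r.
- by rewrite sym_mulDl sym_mulDr IHy IHy'.
- by rewrite !sym_mulE mulrC; apply: sym_monP; rewrite perm_catC.
Qed.

Lemma sym_mulA : associative sym_mul.
Proof.
move=> x y z.
elim/symalg_ind: x => [|x x' IHx IHx'|r w]; first by rewrite !sym_mul0l.
  by rewrite !sym_mulDl IHx IHx'.
elim/symalg_ind: y => [|y y' IHy IHy'|r' w'].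
- by rewrite !(sym_mul0l, sym_mul0r).
- by rewrite !(sym_mulDl, sym_mulDr) IHy IHy'.
elim/symalg_ind: z => [|z z' IHz IHz'|r'' w''].
- by rewrite !(sym_mul0l, sym_mul0r).
- by rewrite !sym_mulDr IHz IHz'.
- by rewrite !sym_mulE mulrA catA.
Qed.

Definition sym_const (r : R) : symalg := sym_mon r [::].
Definition sym_iota (m : M) : symalg := sym_mon 1 [:: m].

Lemma sym_mul1 : left_id (sym_const 1) sym_mul.
Proof.
elim/symalg_ind=> [|x x' IHx IHx'|r w]; first by rewrite sym_mul0r.
- by rewrite sym_mulDr IHx IHx'.
- by rewrite sym_mulE mul1r.
Qed.

Lemma sym_addN : left_inverse 0 (sym_mul (sym_const (- 1))) +%R.
Proof.
move=> x; rewrite -[X in _ + X]sym_mul1 -sym_mulDl /sym_const -sym_monDc addNr.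
by rewrite sym_mon0c sym_mul0l.
Qed.

HB.instance Definition _ := GRing.Nmodule_isZmodule.Build symalg sym_addN.
HB.instance Definition _ := GRing.Zmodule_isComPzRing.Build symalg
  sym_mulA sym_mulC sym_mul1 sym_mulDl.

Lemma sym_constB : zmod_morphism sym_const.
Proof.
move=> r s; apply/(addIr (sym_const s)).
by rewrite subrK /sym_const -sym_monDc subrK.
Qed.

Lemma sym_constM : monoid_morphism sym_const.
Proof. by split=> // r s; rewrite [RHS]sym_mulE. Qed.

HB.instance Definition _ :=
  GRing.isZmodMorphism.Build R _ sym_const sym_constB.
HB.instance Definition _ :=
  GRing.isMonoidMorphism.Build R _ sym_const sym_constM.
HB.instance Definition _ := hasAlgMap.Build R symalg sym_const.

Lemma sym_monM r w r' w' :
  sym_mon r w * sym_mon r' w' = sym_mon (r * r') (w ++ w').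
Proof. exact: sym_mulE. Qed.

Lemma sym_monE r w : sym_mon r w = sym_const r * \prod_(m <- w) sym_iota m.
Proof.
elim: w r => [|m w IH] r.
  by rewrite big_nil mulr1.
rewrite big_cons mulrCA -IH mulrC sym_monM mulr1.
by apply: sym_monP; rewrite cats1 perm_sym perm_rcons.
Qed.

Lemma sym_iota_linear : linear (sym_iota : M -> algmod symalg).
Proof.
move=> r m m'; rewrite /sym_iota sym_monD sym_monZ mul1r; congr (_ + _).
by rewrite algmodZ sym_monM mulr1.
Qed.

(* The grading: the direct sum decomposition, with S^0 = R and S^1 = M. *)
Definition sym_power (n : nat) (x : symalg) : Prop :=
  exists2 s : seq (R * seq M),
    all (fun k => size k.2 == n) s & x = \sum_(k <- s) sym_mon k.1 k.2.

Definition sym_comp (n : nat) : symalg -> symalg :=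
  pres_lift (fun k => if size k.2 == n then sym_mon k.1 k.2 else 0).

Lemma sym_comp_compat n : pres_compat sym_rel
  (fun k => if size k.2 == n then sym_mon k.1 k.2 else 0).
Proof.
apply: (@sym_compat _ (fun r w => if size w == n then sym_mon r w else 0)).
- by move=> *; case: ifP; rewrite ?addr0 ?sym_monDc.
- by move=> *; rewrite sym_mon0c if_same.
- by move=> * /=; case: ifP; rewrite ?addr0 ?sym_monD.
- by move=> * /=; case: ifP; rewrite ?sym_monZ.
- by move=> r w w' ww'; rewrite (perm_size ww') (sym_monP r ww').
Qed.

Lemma sym_compE n s : sym_comp n (\sum_(k <- s) sym_mon k.1 k.2) =
  \sum_(k <- s | size k.2 == n) sym_mon k.1 k.2.
Proof.
have -> : \sum_(k <- s) sym_mon k.1 k.2 = \pi_symalg s.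
  by rewrite [RHS]pres_piE; apply: eq_bigr => -[].
by rewrite [LHS](pres_liftE _ (sym_comp_compat n)) -big_mkcond.
Qed.

Lemma sym_comp_power n x : sym_power n (sym_comp n x).
Proof.
elim/pres_piW: x => s; exists [seq k <- s | size k.2 == n].
  exact: filter_all.
rewrite big_filter -sym_compE; congr sym_comp.
by rewrite [LHS]pres_piE; apply: eq_bigr => -[].
Qed.

Lemma sym_comp_id m n x : sym_power m x -> sym_comp n x = if m == n then x else 0.
Proof.
case=> s /allP sm ->; rewrite sym_compE; case: eqVneq => [<-|mn].
  by rewrite big_seq_cond [RHS]big_seq; apply: eq_bigl => k;
     case: (boolP (k \in s)) => //= /sm.
rewrite big_seq_cond big1 // => k /andP[/sm/eqP km].
by rewrite km (negbTE mn).
Qed.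

Lemma sym_comp_sum x : exists N, x = \sum_(n < N) sym_comp n x.
Proof.
elim/pres_piW: x => s; exists (\max_(k <- s) size k.2).+1.
have -> : \pi_symalg s = \sum_(k <- s) sym_mon k.1 k.2.
  by rewrite [LHS]pres_piE; apply: eq_bigr => -[].
under [RHS]eq_bigr do rewrite sym_compE big_mkcond.
rewrite exchange_big /=; apply: eq_big_seq => k ks.
have kN : (size k.2 < (\max_(k <- s) size k.2).+1)%N.
  by rewrite ltnS; apply: (@leq_bigmax_seq _ _ xpredT (fun k => size k.2)).
rewrite (bigD1 (Ordinal kN)) //= eqxx big1 ?addr0 // => i.
by rewrite eq_sym -val_eqE /= => /negbTE ->.
Qed.

Lemma sym_power0 x : sym_power 0 x <-> exists r, x = sym_const r.
Proof.
split=> [[s + ->]|[r ->]]; last by exists [:: (r, [::])]; rewrite ?big_seq1.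
elim: s => [|[r w] s IH] /=; first by exists 0; rewrite big_nil /sym_const sym_mon0c.
case/andP=> /nilP -> /IH [r' E]; exists (r + r').
by rewrite big_cons E -sym_monDc.
Qed.

Lemma sym_power1 x : sym_power 1 x <-> exists m, x = sym_iota m.
Proof.
split=> [[s + ->]|[m ->]]; last by exists [:: (1, [:: m])]; rewrite ?big_seq1.
elim: s => [|[r [|m [|m' w]]] s IH] //=.
  exists 0; rewrite big_nil -(scale0r (0 : M)) /sym_iota sym_monZ mulr0.
  by rewrite sym_mon0c.
case/IH=> m' E; exists (r *: m + m').
by rewrite big_cons E /sym_iota sym_monD sym_monZ mul1r.
Qed.

Lemma sym_const_inj : injective sym_const.
Proof.
pose c := pres_lift (E := sym_rel) (fun k => if nilp k.2 then k.1 else 0).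
suff cK r : c (sym_const r) = r by exact: can_inj cK.
apply: (pres_lift_gen (r, [::])).
apply: (@sym_compat _ (fun r w => if nilp w then r else 0)) => //=.
- by move=> *; case: ifP; rewrite ?addr0.
- by move=> *; rewrite if_same.
- by move=> *; rewrite addr0.
- by move=> {}r w w' ww'; rewrite /nilp (perm_size ww').
Qed.

Lemma sym_iota_inj : injective sym_iota.
Proof.
pose F r (w : seq M) := if w is [:: m] then r *: m else 0.
pose c := pres_lift (E := sym_rel) (fun k => F k.1 k.2).
suff cK m : c (sym_iota m) = m by exact: can_inj cK.
rewrite -[RHS]scale1r; apply: (pres_lift_gen (1, [:: m])).
apply: (@sym_compat _ F) => //=.
- by move=> r r' [|? []]; rewrite /= ?addr0 ?scalerDl.
- by move=> [|? []] //=; rewrite scale0r.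
- by move=> r ? ? []; rewrite ?scalerDr ?addr0.
- by move=> r c' ? []; rewrite //= scalerA.
- move=> r [|x [|? ?]] [|y [|? ?]] ww' //=; try by have := perm_size ww'.
  by have [->] := perm_small_eq (isT : (size [:: y] <= 1)%N) ww'.
Qed.

End SymmetricAlgebra.

Section FreeAveraging.
Variables (R : comPzRingType) (A : pzComAlgType R).

Definition freeavg := algtensor A (symalg (algmod A)).
HB.instance Definition _ := PzComAlg.on freeavg.

Definition freeavg_op : freeavg -> freeavg :=
  pres_lift (fun k : A * symalg (algmod A) => algtens 1 (sym_iota (k.1 : algmod A) * k.2)).

Definition freeavg_in (a : A) : freeavg := algtens a 1.

Lemma freeavg_op_compat :
  pres_compat (@tensor_rel R (algmod A) (algmod (symalg (algmod A))))
    (fun k : A * symalg (algmod A) =>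
       algtens 1 (sym_iota (k.1 : algmod A) * k.2) : freeavg).
Proof.
have iD (a b : algmod A) : sym_iota (a + b) = sym_iota a + sym_iota b.
  by rewrite -{1}(scale1r a) sym_iota_linear scale1r.
have i0 : sym_iota (0 : algmod A) = 0.
  by apply: (addrI (sym_iota (0 : algmod A))); rewrite -iD !addr0.
have iZ r (a : algmod A) :
    sym_iota (r *: a) = r *: (sym_iota a : algmod (symalg (algmod A))).
  by rewrite -(addr0 (r *: a)) sym_iota_linear i0 addr0.
apply: (@tensor_compat _ (algmod A) (algmod (symalg (algmod A))) _
  (fun a s => algtens 1 (sym_iota (a : algmod A) * s) : freeavg)).
- by move=> *; rewrite iD mulrDl algtensDr.
- by move=> *; rewrite mulrDr algtensDr.
- by move=> *; rewrite i0 mul0r [LHS]tens0r.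
- by move=> *; rewrite mulr0 [LHS]tens0r.
- move=> r a s; rewrite iZ; congr algtens.
  by rewrite !algmodZ -mulrA mulrCA.
Qed.

Lemma freeavg_opE (a : A) (s : symalg (algmod A)) :
  freeavg_op (algtens a s) = algtens 1 (sym_iota (a : algmod A) * s).
Proof. exact: (pres_lift_gen (a, s) freeavg_op_compat). Qed.

Lemma freeavg_op0 : freeavg_op 0 = 0.
Proof. exact: (pres_lift0 freeavg_op_compat). Qed.

Lemma freeavg_opD : {morph freeavg_op : x y / x + y}.
Proof. exact: (pres_liftD freeavg_op_compat). Qed.

Lemma freeavg_op_linear : linear (freeavg_op : algmod freeavg -> algmod freeavg).
Proof.
move=> r x y; rewrite [LHS]freeavg_opD; congr (_ + _).
elim/algtensor_ind: x => [|x x' IHx IHx'|a s].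
- by rewrite scaler0 freeavg_op0 scaler0.
- rewrite scalerDr [LHS]freeavg_opD IHx IHx' freeavg_opD.
  exact/esym/scalerDr.
- rewrite [_ *: _]algtensZr !freeavg_opE [RHS]algtensZr.
  by rewrite algmod_scalerAr.
Qed.

End FreeAveraging.

(* Main.v *)
(* An element y of an averaging algebra (B, g) with g(xy) = g(x)y for all x may be
   called averaged. The averaged elements form a subalgebra, which contains the
   image of g. An averaging homomorphism psi extending phi must send 1 (x) a, which
   is f_A(a (x) 1), to g(phi a), so psi(a (x) a1...an) = phi(a) g(phi a1)...g(phi an).
   The universal properties of S(A) and of the tensor product of algebras give an
   algebra homomorphism with these values; it commutes with the operators because
   it maps 1 (x) S(A) to averaged elements. *)
Require Import Defs.
From mathcomp Require Import all_boot all_algebra.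
From mathcomp Require Import boolp.

Set Implicit Arguments.
Unset Strict Implicit.
Unset Printing Implicit Defensive.

Import GRing.Theory.
Local Open Scope ring_scope.

Section Linear.
Variables (R : comPzRingType) (M N : lmodType R) (f : M -> N).
Hypothesis fL : linear f.

Lemma linear_add x y : f (x + y) = f x + f y.
Proof. by rewrite -{1}(scale1r x) fL scale1r. Qed.

Lemma linear_zero : f 0 = 0.
Proof. by apply: (addrI (f 0)); rewrite -linear_add !addr0. Qed.

Lemma linear_scale r x : f (r *: x) = r *: f x.
Proof. by rewrite -(addr0 (r *: x)) fL linear_zero addr0. Qed.

End Linear.

(** The ring-level form of homogeneity, usable inside products in A and B where no scaling is
    visible. *)
Lemma linear_alg_mapM (R : comPzRingType) (A B : pzComAlgType R) (f : A -> B) r x :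
  linear (f : algmod A -> algmod B) -> f (alg_map r * x) = alg_map r * f x.
Proof. by move=> fL; rewrite -(algmodZ r (x : algmod A)) (linear_scale fL). Qed.

Section AlgHom.
Variable R : comPzRingType.

Lemma alg_hom_const (A B : pzComAlgType R) (f : A -> B) r :
  is_alg_hom f -> f (alg_map r) = alg_map r.
Proof.
move=> [fL [f1 _]].
by rewrite -[LHS](congr1 f (mulr1 _)) linear_alg_mapM // f1 mulr1.
Qed.

Lemma alg_hom_comp (A B C : pzComAlgType R) (f : A -> B) (h : B -> C) :
  is_alg_hom f -> is_alg_hom h -> is_alg_hom (h \o f).
Proof.
move=> [fL [f1 fM]] [hL [h1 hM]]; split; first by move=> r x y /=; rewrite fL hL.
by split=> [|x y] /=; rewrite ?f1 ?fM.
Qed.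

End AlgHom.

Section SymLift.
Variables (R : comPzRingType) (M : lmodType R) (B : pzComAlgType R).

(** For linear f, the extension of f to S(M) given by the universal property. For other f the value
    may depend on the representative chosen by [pres_lift]. *)
Definition sym_lift (f : M -> B) : symalg M -> B :=
  pres_lift (fun k => alg_map k.1 * \prod_(m <- k.2) f m).

Variable f : M -> B.
Hypothesis fL : linear (f : M -> algmod B).

(** One case per relation of [sym_rel]; invariance under permutations rests on the commutativity of
    B. *)
Lemma sym_lift_compat :
  pres_compat (@sym_rel R M) (fun k => alg_map k.1 * \prod_(m <- k.2) f m).
Proof.
apply: (@sym_compat R M B (fun r w => alg_map r * \prod_(m <- w) f m)).
- by move=> *; rewrite rmorphD mulrDl.
- by move=> *; rewrite rmorph0 mul0r.
- by move=> *; rewrite !big_cons [f _](linear_add fL) mulrDl mulrDr.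
- by move=> *; rewrite !big_cons [f _](linear_scale fL) algmodZ rmorphM !mulrA.
- by move=> r w w' ww'; rewrite (perm_big _ ww').
Qed.

Lemma sym_liftE r w : sym_lift f (sym_mon r w) = alg_map r * \prod_(m <- w) f m.
Proof. exact: (pres_lift_gen (r, w) sym_lift_compat). Qed.

Lemma sym_lift0 : sym_lift f 0 = 0.
Proof. exact: (pres_lift0 sym_lift_compat). Qed.

Lemma sym_liftD : {morph sym_lift f : x y / x + y}.
Proof. exact: (pres_liftD sym_lift_compat). Qed.

Lemma sym_lift_iota m : sym_lift f (sym_iota m) = f m.
Proof. by rewrite sym_liftE rmorph1 mul1r big_seq1. Qed.

Lemma sym_lift_hom : is_alg_hom (sym_lift f).
Proof.
(* Multiplicativity comes first because linearity follows from it: scaling by r is multiplication by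
   the constant r. *)
have fM : {morph sym_lift f : x y / x * y}.
  elim/symalg_ind=> [|x x' IHx IHx'|r w] y; first by rewrite !mul0r sym_lift0 mul0r.
    by rewrite mulrDl !sym_liftD IHx IHx' mulrDl.
  elim/symalg_ind: y => [|y y' IHy IHy'|r' w'].
  - by rewrite mulr0 sym_lift0 mulr0.
  - by rewrite mulrDr !sym_liftD IHy IHy' mulrDr.
  - by rewrite sym_monM !sym_liftE rmorphM big_cat mulrACA.
split=> [r x y|]; last by split=> //; rewrite [LHS]sym_liftE rmorph1 mul1r big_nil.
rewrite algmodZ [LHS]sym_liftD fM; congr (_ * _ + _).
by rewrite [LHS]sym_liftE big_nil mulr1.
Qed.

(** By [sym_monE], S(M) is generated as an algebra by the image of M. *)
Lemma sym_hom_eq (h k : symalg M -> B) : is_alg_hom h -> is_alg_hom k ->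
  h \o @sym_iota R M =1 k \o @sym_iota R M -> h =1 k.
Proof.
move=> hH kH hk; have [[hL [h1 hM]] [kL [k1 kM]]] := (hH, kH).
elim/symalg_ind=> [|x y IHx IHy|r w].
- by rewrite [LHS](linear_zero hL) [RHS](linear_zero kL).
- by rewrite [LHS](linear_add hL) [RHS](linear_add kL) IHx IHy.
rewrite sym_monE hM kM; congr (_ * _).
  by rewrite [LHS](alg_hom_const r hH) [RHS](alg_hom_const r kH).
elim: w => [|m w IH]; first by rewrite !big_nil h1 k1.
by rewrite !big_cons hM kM IH; congr (_ * _); apply: hk.
Qed.

End SymLift.

Section TensorLift.
Variables (R : comPzRingType) (A B C : pzComAlgType R).

Lemma algtens_homl : is_alg_hom (fun a => algtens a 1 : algtensor A B).
Proof.
split=> [r a a'|]; first by rewrite algtensZl [LHS]algtensDl.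
by split=> // a a'; rewrite algtensM mulr1.
Qed.

Lemma algtens_homr : is_alg_hom (fun b => algtens 1 b : algtensor A B).
Proof.
split=> [r b b'|]; first by rewrite algtensZr [LHS]algtensDr.
by split=> // b b'; rewrite algtensM mulr1.
Qed.

(** For algebra homomorphisms u and v, the induced map out of the coproduct of A and B among
    commutative algebras. *)
Definition algtensor_lift (u : A -> C) (v : B -> C) : algtensor A B -> C :=
  pres_lift (fun k => u k.1 * v k.2).

(** Pure tensors factor as (a (x) 1)(1 (x) b), and they span. *)
Lemma algtensor_hom_eq (h k : algtensor A B -> C) : is_alg_hom h -> is_alg_hom k ->
  (forall a, h (algtens a 1) = k (algtens a 1)) ->
  (forall b, h (algtens 1 b) = k (algtens 1 b)) -> h =1 k.
Proof.
move=> [hL [_ hM]] [kL [_ kM]] hkA hkB; elim/algtensor_ind=> [|x y IHx IHy|a b].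
- by rewrite [LHS](linear_zero hL) [RHS](linear_zero kL).
- by rewrite [LHS](linear_add hL) [RHS](linear_add kL) IHx IHy.
- by rewrite -[a]mulr1 -[b]mul1r -algtensM hM kM hkA hkB.
Qed.

Variables (u : A -> C) (v : B -> C).
Hypotheses (uH : is_alg_hom u) (vH : is_alg_hom v).

Lemma algtensor_lift_compat :
  pres_compat (@tensor_rel R (algmod A) (algmod B)) (fun k => u k.1 * v k.2).
Proof.
have [[uL _] [vL _]] := (uH, vH).
apply: (@tensor_compat R (algmod A) (algmod B) C (fun a b => u a * v b)) => *.
- by rewrite [u _](linear_add uL) mulrDl.
- by rewrite [v _](linear_add vL) mulrDr.
- by rewrite [u _](linear_zero uL) mul0r.
- by rewrite [v _](linear_zero vL) mulr0.
- by rewrite [u _](linear_scale uL) [v _ in RHS](linear_scale vL) !algmodZ mulrCA mulrA.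
Qed.

Lemma algtensor_liftE a b : algtensor_lift u v (algtens a b) = u a * v b.
Proof. exact: (pres_lift_gen (a, b) algtensor_lift_compat). Qed.

Lemma algtensor_lift0 : algtensor_lift u v 0 = 0.
Proof. exact: (pres_lift0 algtensor_lift_compat). Qed.

Lemma algtensor_liftD : {morph algtensor_lift u v : x y / x + y}.
Proof. exact: (pres_liftD algtensor_lift_compat). Qed.

Lemma algtensor_lift_hom : is_alg_hom (algtensor_lift u v).
Proof.
have [[uL [u1 uM]] [vL [v1 vM]]] := (uH, vH); split; last split.
- move=> r x y; rewrite [LHS]algtensor_liftD; congr (_ + _).
  elim/algtensor_ind: x => [|x x' IHx IHx'|a b].
  + by rewrite scaler0 algtensor_lift0 scaler0.
  + by rewrite scalerDr [LHS]algtensor_liftD IHx IHx' algtensor_liftD [RHS]scalerDr.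
  + rewrite algtensZl [LHS]algtensor_liftE [u _](linear_scale uL).
    by rewrite algtensor_liftE algmod_scalerAl.
- by rewrite algtens1 algtensor_liftE u1 v1 mulr1.
elim/algtensor_ind=> [|x x' IHx IHx'|a b] y.
- by rewrite mul0r algtensor_lift0 mul0r.
- by rewrite mulrDl !algtensor_liftD IHx IHx' mulrDl.
elim/algtensor_ind: y => [|y y' IHy IHy'|a' b'].
- by rewrite mulr0 algtensor_lift0 mulr0.
- by rewrite mulrDr !algtensor_liftD IHy IHy' mulrDr.
- by rewrite algtensM !algtensor_liftE uM vM mulrACA.
Qed.

End TensorLift.

Section Averaging.
Variables (R : comPzRingType) (B : pzComAlgType R) (g : B -> B).
Hypothesis gA : is_averaging g.

Lemma averaging_prod (I : Type) (w : seq I) (y : I -> B) x :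
  g (x * \prod_(i <- w) g (y i)) = g x * \prod_(i <- w) g (y i).
Proof.
(* x stays general so that it can absorb the first factor g (y i). *)
elim: w x => [|i w IH] x; first by rewrite !big_nil !mulr1.
by rewrite !big_cons mulrA IH gA.2 mulrA.
Qed.

(** The values of this lift are sums of scalar multiples of products of values of g. Linearity of g
    handles sums and scalars, [averaging_prod] the products. *)
Lemma averaging_sym_lift (M : lmodType R) (f : M -> B) x s :
  linear (f : M -> algmod B) ->
  g (x * sym_lift (g \o f) s) = g x * sym_lift (g \o f) s.
Proof.
have [gL _] := gA => fL.
have gfL : linear (g \o f : M -> algmod B) by move=> r m n /=; rewrite fL gL.
elim/symalg_ind: s => [|s t IHs IHt|r w].
- by rewrite sym_lift0 // !mulr0 [LHS](linear_zero gL).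
- by rewrite sym_liftD // !mulrDr [LHS](linear_add gL) IHs IHt.
- by rewrite sym_liftE // mulrCA (linear_alg_mapM _ _ gL) averaging_prod mulrCA.
Qed.

End Averaging.

(** For x = a (x) s and y = b (x) t, both sides equal 1 (x) asbt, since multiplying by 1 (x) bt
    leaves the first factor alone. *)
Lemma freeavg_op_averaging (R : comPzRingType) (A : pzComAlgType R) :
  is_averaging (@freeavg_op R A).
Proof.
split=> [|x y]; first exact: freeavg_op_linear.
elim/algtensor_ind: x => [|x x' IHx IHx'|a s].
- by rewrite mul0r freeavg_op0 mul0r.
- by rewrite mulrDl !freeavg_opD IHx IHx' mulrDl.
elim/algtensor_ind: y => [|y y' IHy IHy'|b t].
- by rewrite freeavg_op0 !mulr0 freeavg_op0.
- by rewrite freeavg_opD !mulrDr freeavg_opD IHy IHy'.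
- by rewrite !freeavg_opE !algtensM freeavg_opE !mulr1 mulrA.
Qed.

Theorem theorem2p6 (R : comPzRingType) (A : pzComAlgType R) :
  is_free_averaging (@freeavg_op R A) (@freeavg_in R A).
Proof.
split=> [||B g phi gA phiH]; first exact: freeavg_op_averaging.
  exact: algtens_homl.
have [[gL _] [phiL [phi1 _]]] := (gA, phiH).
have gphiL : linear (g \o phi : algmod A -> algmod B).
  by move=> r a b /=; rewrite phiL gL.
pose S := @sym_lift R (algmod A) B (g \o phi).
have sH : is_alg_hom S := sym_lift_hom gphiL; have [_ [s1 sM]] := sH.
have psiH := algtensor_lift_hom phiH sH.
exists (algtensor_lift phi S); split.
  split=> [|a /=]; last by rewrite algtensor_liftE // s1 mulr1.
  split=> // x /=; elim/algtensor_ind: x => [|x y IHx IHy|a s].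
  - by rewrite freeavg_op0 algtensor_lift0 // (linear_zero gL).
  - by rewrite freeavg_opD !algtensor_liftD // [RHS](linear_add gL) IHx IHy.
  (* The two sides become g (phi a) * S s and g (phi a * S s), equal because S s is averaged. *)
  - rewrite freeavg_opE !algtensor_liftE // phi1 mul1r sM.
    rewrite [S (sym_iota _)](sym_lift_iota gphiL).
    by rewrite [RHS](averaging_sym_lift gA).
move=> psi [[psi'H psig] psii]; apply: funext.
apply: (algtensor_hom_eq psiH psi'H) => [a|].
  by rewrite algtensor_liftE // s1 mulr1; apply: psii.
(* On 1 (x) S(A) both maps are algebra homomorphisms from S(A), so it suffices to compare them on
   A. *)
apply: (@sym_hom_eq _ _ _ (algtensor_lift _ _ \o algtens 1) (psi \o algtens 1)).
- exact: alg_hom_comp (algtens_homr _ _) psiH.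
- exact: alg_hom_comp (algtens_homr _ _) psi'H.
move=> a /=; rewrite algtensor_liftE // phi1 mul1r [LHS](sym_lift_iota gphiL) /=.
(* Here 1 (x) a is recognised as the image of a (x) 1 under [freeavg_op], which forces the value g
   (phi a). *)
by rewrite -[sym_iota a]mulr1 -freeavg_opE [RHS]psig /= psii.
Qed.
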